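(* For integers $r\ge 2$ and $k\ge r-1$, $\chi_l(K_{(r+1)*(r-1),r*(k-r+1)}^r)=k$.
   Context: All hypergraphs are finite. A vertex coloring of a hypergraph is proper if no edge is monochromatic. A $k$-list assignment $L$ assigns to each vertex $v$ a set $L(v)$ of exactly $k$ colors; an $L$-coloring is a proper coloring with each vertex $v$ colored from $L(v)$; $\chi_l(H)$ is the least $k$ such that $H$ is $L$-colorable for every $k$-list assignment $L$. For positive integers $p_1,\dots,p_k$ and disjoint sets $V_1,\dots,V_k$ with $|V_i|=p_i$, the hypergraph $K^r_{p_1,\dots,p_k}$ has vertex set $V_1\cup\cdots\cup V_k$ and edge set consisting of all $r$-subsets $S$ of the vertex set with $S\not\subseteq V_i$ for every $i$. $K_{(r+1)*(r-1),r*(k-r+1)}^r$ denotes this hypergraph with $r-1$ parts of size $r+1$ and $k-r+1$ parts of size $r$ (so $k$ parts in total). *)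

(* Defs.v *)
From mathcomp Require Import all_boot finmap.

Set Implicit Arguments.
Unset Strict Implicit.
Unset Printing Implicit Defensive.

Local Open Scope fset_scope.

(* A hypergraph on the finite vertex type T is given by its edge set
   H : {set {set T}}. *)

Definition monochromatic (T : finType) (C : Type) (c : T -> C) (e : {set T}) :
    Prop :=
  forall x y, x \in e -> y \in e -> c x = c y.

Definition proper (T : finType) (C : Type) (H : {set {set T}}) (c : T -> C) :
    Prop :=
  forall e, e \in H -> ~ monochromatic c e.

Definition list_assignment (T : finType) (C : choiceType) (k : nat)
    (L : T -> {fset C}) : Prop :=
  forall v, #|` L v| = k.

Definition list_colorable (T : finType) (C : choiceType) (H : {set {set T}})
    (L : T -> {fset C}) : Prop :=
  exists c : T -> C, proper H c /\ forall v, c v \in L v.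

(* The color type C is quantified here, so no palette is fixed in advance. *)
Definition choosable (T : finType) (H : {set {set T}}) (k : nat) : Prop :=
  forall (C : choiceType) (L : T -> {fset C}),
    list_assignment k L -> list_colorable H L.

(* chi_l(H) = k. This is a relation because no such k exists when H has an edge
   with at most one vertex. *)
Definition is_list_chromatic_number (T : finType) (H : {set {set T}})
    (k : nat) : Prop :=
  choosable H k /\ forall j, choosable H j -> k <= j.

(* The disjoint union of the parts V_i, with |V_i| the i-th entry of p. *)
Definition vertex (p : seq nat) : finType :=
  {i : 'I_(size p) & 'I_(nth 0 p i)}.

Definition part (p : seq nat) (i : 'I_(size p)) : {set vertex p} :=
  [set v | tag v == i].

Definition complete_multipartite (r : nat) (p : seq nat) :
    {set {set vertex p}} :=
  [set S : {set vertex p} | (#|S| == r) && [forall i, ~~ (S \subset part i)]].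

(* Main.v *)
Require Import Defs.
From mathcomp Require Import all_boot finmap zify.

(* Put b = r - 1. A colouring is proper iff every colour class has at most b
   vertices or lies in one part. For the upper bound, induct on the number of
   vertices, allowing k parts of size at most b + 2, at most b of them of size
   b + 2. A colour common to all the lists of a part is used on that part. If
   the bound |Y| <= b |L(Y)| of Hall's theorem fails only on proper subsets Y,
   colour a maximal such Y by induction and the other vertices by Hall's theorem
   with colours outside L(Y). Otherwise the whole vertex set violates it, so
   there are few colours; as no part has a common colour, counting incidences
   produces distinct colours each lying in b + 1 lists of its own part of size
   b + 2. Using those on b + 1 vertices restores Hall's condition. *)

Set Implicit Arguments.
Unset Strict Implicit.
Unset Printing Implicit Defensive.

(** * Neighbourhoods L(Y) in the vertex-colour incidence graph *)

Definition colors_on (V C : finType) (L : V -> {set C}) (Y : {set V}) :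
    {set C} :=
  \bigcup_(v in Y) L v.

(** Serves two purposes: for the map to parts it is the trace of a part on [X], for a colouring it
    is a colour class. *)
Definition fiber (V I : finType) (p : V -> I) (X : {set V}) (i : I) : {set V} :=
  [set v in X | p v == i].

Section Colors.

Variables (V C : finType) (L : V -> {set C}).
Implicit Types (Y Z : {set V}) (D : {set C}).

Lemma colors_onS Y Z : Y \subset Z -> colors_on L Y \subset colors_on L Z.
Proof.
by move=> /subsetP YZ; apply/bigcupsP=> v /YZ vZ; apply: (bigcup_max v).
Qed.

Lemma sub_colors_on v Y : v \in Y -> L v \subset colors_on L Y.
Proof. by move=> vY; apply: (bigcup_max v). Qed.

Lemma colors_onU Y Z : colors_on L (Y :|: Z) = colors_on L Y :|: colors_on L Z.
Proof. exact: bigcup_setU. Qed.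

Lemma colors_onD D Y :
  colors_on (fun v => L v :\: D) Y = colors_on L Y :\: D.
Proof.
apply/setP=> c; rewrite inE; apply/bigcupP/andP.
  case=> v vY; rewrite inE => /andP[cD cL]; split=> //.
  by apply/bigcupP; exists v.
by case=> cD /bigcupP[v vY cL]; exists v; rewrite // inE cD.
Qed.

Lemma sum_card_lists (Y : {set V}) :
  \sum_(v in Y) #|L v| =
  \sum_(c in colors_on L Y) #|[set v in Y | c \in L v]|.
Proof.
transitivity (\sum_(v in Y) \sum_(c in colors_on L Y | c \in L v) 1).
  apply: eq_bigr => v vY; rewrite -sum1_card; apply: eq_bigl => c.
  by rewrite andb_idl //; apply/subsetP/sub_colors_on.
rewrite (exchange_big_dep [in colors_on L Y]) /=; last by move=> v c _ /andP[].
apply: eq_bigr => c cN; rewrite -sum1dep_card.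
by apply: eq_bigl => v; rewrite cN.
Qed.

End Colors.

(** * Hall's theorem, plain and with capacities *)

Theorem Hall (V C : finType) (c0 : C) (L : V -> {set C}) (X : {set V}) :
    (forall Y : {set V}, Y \subset X -> #|Y| <= #|colors_on L Y|) ->
  exists2 f : V -> C, {in X, forall v, f v \in L v} & {in X &, injective f}.
Proof.
have [n] := ubnP #|X|; elim: n X L => // n IHn X L /ltnSE-leXn hallX.
(* Split on a nonempty proper tight set [Y]: it is matched inside L(Y), the rest outside L(Y). *)
have [/existsP[Y /and3P[Y0 YX /eqP tightY]] | noY] :=
    boolP [exists Y : {set V},
             [&& Y != set0, Y \proper X & #|Y| == #|colors_on L Y|]].
  have [|Z ZY|f1 f1L f1inj] := IHn Y L.
  - exact: leq_trans (proper_card YX) leXn.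
  - exact/hallX/(subset_trans ZY)/proper_sub.
  have [||f2 f2L f2inj] := IHn (X :\: Y) (fun v => L v :\: colors_on L Y).
  - apply: leq_trans leXn; rewrite -(cardsID Y X) (setIidPr (proper_sub YX)).
    by rewrite -[X in X < _]add0n ltn_add2r card_gt0.
  - move=> Z; rewrite subsetD => /andP[ZX dZY]; rewrite colors_onD.
    (* Hall's condition for [Y :|: Z] minus the equality for [Y] gives the condition for [Z]. *)
    have := hallX (Y :|: Z); rewrite subUset ZX (proper_sub YX) => /(_ isT).
    have /eqP YZ0 : Y :&: Z == set0 by rewrite setIC setI_eq0.
    rewrite colors_onU !cardsU tightY YZ0 cards0 cardsD.
    rewrite [colors_on L Z :&: _]setIC.
    by have := subset_leq_card (subsetIl (colors_on L Y) (colors_on L Z)); lia.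
  have f12 u v : u \in Y -> v \in X -> v \notin Y -> f1 u <> f2 v.
    move=> uY vX vNY fuv; have := f2L v; rewrite !inE vX vNY => /(_ isT)/andP[].
    by rewrite -fuv (subsetP (sub_colors_on L uY)) // f1L.
  exists (fun v => if v \in Y then f1 v else f2 v).
    move=> v vX; case: ifPn => vY; first exact: f1L.
    by have := f2L v; rewrite !inE vX vY => /(_ isT)/andP[].
  move=> u v uX vX; case: ifPn => uY; case: ifPn => vY.
  - exact: f1inj.
  - by move/(f12 _ _ uY vX vY).
  - by move/esym/(f12 _ _ vY uX uY).
  - by apply: f2inj; rewrite inE ?uX ?vX ?uY ?vY.
(* Now every nonempty proper subset has a spare colour, so any vertex may take any colour of its
   list. The default [c0] serves empty [X]. *)
have [->|[v vX]] := set_0Vmem X; first by exists (fun=> c0) => u; rewrite inE.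
have [c cv] : exists c, c \in L v.
  apply/set0Pn; rewrite -card_gt0.
  have := hallX [set v]; rewrite sub1set vX cards1.
  by rewrite /colors_on big_set1 => /(_ isT).
have [||f fL finj] := IHn (X :\ v) (fun u => L u :\ c).
- by apply: leq_trans leXn; rewrite (cardsD1 v X) vX.
- move=> Y YXv; have [->|Y0] := eqVneq Y set0; first by rewrite cards0.
  have YX : Y \proper X.
    by apply: sub_proper_trans YXv _; rewrite properD1.
  have := hallX Y (proper_sub YX); rewrite leq_eqVlt; case/orP=> [tY|].
    by case/negP: noY; apply/existsP; exists Y; rewrite Y0 YX.
  rewrite (colors_onD L [set c]) (cardsD1 c (colors_on L Y)).
  by case: (_ \in _) => /=; lia.
have fNc u : u \in X -> u != v -> f u <> c.
  by move=> uX uv fu; have := fL u; rewrite !inE uv uX fu eqxx => /(_ isT).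
exists (fun u => if u == v then c else f u).
  move=> u uX; case: eqVneq => [->//|uv].
  by have := fL u; rewrite !inE uv uX => /(_ isT)/andP[].
move=> u w uX wX; case: eqVneq => [->|uv]; case: eqVneq => [->|wv] //.
- by move/esym/(fNc _ wX wv).
- by move/(fNc _ uX uv).
- by apply: finj; rewrite !inE ?uv ?wv ?uX ?wX.
Qed.

(** Hall's theorem with b copies of each colour: the copy index is injective on a colour class. *)
Lemma Hall_capacity (V C : finType) (c0 : C) (b : nat) (L : V -> {set C})
    (X : {set V}) : 0 < b ->
    (forall Y : {set V}, Y \subset X -> #|Y| <= b * #|colors_on L Y|) ->
  exists2 f : V -> C, {in X, forall v, f v \in L v} &
    forall c, #|fiber f X c| <= b.
Proof.
case: b => // b _ hallX.
have [|g gL ginj] := @Hall V (C * 'I_b.+1)%type (c0, ord0)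
                        (fun v => setX (L v) setT) X.
  move=> Y YX; rewrite (_ : colors_on _ Y = setX (colors_on L Y) setT).
    by rewrite cardsX cardsT card_ord mulnC hallX.
  apply/setP=> -[c i]; rewrite in_setX in_setT andbT; apply/bigcupP/bigcupP.
    by case=> v vY; rewrite in_setX => /andP[cv _]; exists v.
  by case=> v vY cv; exists v; rewrite // in_setX cv in_setT.
exists (fun v => (g v).1).
  by move=> v /gL; rewrite [g v]surjective_pairing in_setX => /andP[].
move=> c; rewrite -[leqRHS]card_ord -cardsT.
have := @card_in_imset _ _ (fun v => (g v).2) (fiber (fun v => (g v).1) X c).
move=> <-; first exact/subset_leq_card/subsetT.
move=> u v; rewrite !inE => /andP[uX /eqP gu] /andP[vX /eqP gv] guv.
apply: ginj => //.
by rewrite [g u]surjective_pairing gu guv -gv -surjective_pairing.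
Qed.

(** * Counting list incidences and vertices per part *)

Lemma card_lists_bound (V C : finType) (L : V -> {set C}) (A : {set V})
    (D : {set C}) (k m : nat) :
    {in A, forall v, k <= #|L v|} ->
    (forall c, #|[set v in A | c \in L v]| <= m + (c \in D)) ->
  k * #|A| <= m * #|colors_on L A| + #|D|.
Proof.
move=> kL mD; apply: (@leq_trans (\sum_(v in A) #|L v|)).
  by rewrite mulnC -sum_nat_const leq_sum.
rewrite sum_card_lists; apply: leq_trans (leq_sum _ (fun c _ => mD c)) _.
rewrite big_split /= sum_nat_const mulnC leq_add2l -big_mkcondr /= sum1dep_card.
by apply/subset_leq_card/subsetP => c; rewrite inE => /andP[].
Qed.

Lemma card_fiberS (V I : finType) (p : V -> I) (i : I) (Y Z : {set V}) :
  Y \subset Z -> #|fiber p Y i| <= #|fiber p Z i|.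
Proof.
move=> /subsetP YZ; apply/subset_leq_card/subsetP=> v.
by rewrite !inE => /andP[/YZ-> ->].
Qed.

Lemma card_fibers (V I : finType) (p : V -> I) (Y : {set V}) (J : {set I}) :
  {in Y, forall v, p v \in J} -> #|Y| = \sum_(i in J) #|fiber p Y i|.
Proof.
move=> pJ; rewrite -sum1_card (partition_big p [in J]) //=.
by apply: eq_bigr => i _; rewrite sum1dep_card.
Qed.

(** Sums the bounds over the parts in [J]: those in [A] save m, those in [B] cost one more. Both
    corrections are additive, to avoid truncated subtraction. *)
Lemma card_fibers_bound (V I : finType) (p : V -> I) (Y : {set V})
    (J A B : {set I}) (m : nat) :
    {in Y, forall v, p v \in J} -> A \subset J ->
    {in J, forall i, #|fiber p Y i| + m * (i \in A) <= m + (i \in B)} ->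
  #|Y| + m * #|A| <= m * #|J| + #|B|.
Proof.
move=> pJ /setIidPl AJ le_fib.
have cardI (E : {set I}) : \sum_(i in J) (i \in E) = #|E :&: J|.
  rewrite -big_mkcondr /= sum1dep_card setIC.
  by apply: eq_card => i; rewrite !inE.
rewrite (card_fibers pJ) -[in X in X <= _]AJ -cardI big_distrr /= -big_split /=.
apply: leq_trans (leq_sum _ le_fib) _.
rewrite big_split /= sum_nat_const mulnC leq_add2l cardI.
by rewrite subset_leq_card // subsetIl.
Qed.

(** * The critical case: the whole vertex set violates Hall's condition *)

Definition good_coloring (V I C : finType) (p : V -> I) (b : nat)
    (L : V -> {set C}) (X : {set V}) (f : V -> C) : Prop :=
  {in X, forall v, f v \in L v} /\
  (forall c, #|fiber f X c| <= b \/
             exists i, {in fiber f X c, forall v, p v = i}).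

(* A partial system (U, f) of representatives picks for each i in U, a part of
   size b + 2, a colour f i lying in b + 1 of its lists; taken maximal, every
   colour lying in b + 1 lists of some other part of size b + 2 is used. *)
Lemma good_coloring_critical (V I C : finType) (p : V -> I) (c0 : C) (b : nat)
    (L : V -> {set C}) (X : {set V}) (J : {set I}) : 0 < b ->
    {in X, forall v, p v \in J} ->
    {in X, forall v, #|J| <= #|L v|} ->
    (forall i, #|fiber p X i| <= b.+2) ->
    #|[set i | #|fiber p X i| == b.+2]| <= b ->
    (forall i c, fiber p X i != set0 ->
       exists2 v, v \in fiber p X i & c \notin L v) ->
    b * #|colors_on L X| < #|X| ->
  exists f, good_coloring p b L X f.
Proof.
move=> b_gt0 pJ JL le_fib; set Big := [set i | _] => leBig nocommon crit.
pose mult i c := #|[set v in fiber p X i | c \in L v]|.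
have lt_mult i c : 0 < #|fiber p X i| -> mult i c < #|fiber p X i|.
  rewrite card_gt0 => /(nocommon i c)[v vi cv]; apply/proper_card/properP.
  split; first by apply/subsetP=> u; rewrite inE => /andP[].
  by exists v; rewrite // inE (negPf cv) andbF.
have BigJ : Big \subset J.
  apply/subsetP=> i; rewrite inE => /eqP iB.
  have /card_gt0P[v] : 0 < #|fiber p X i| by rewrite iB.
  by rewrite inE => /andP[/pJ + /eqP<-].
have leBigJ := subset_leq_card BigJ.
pose valid (x : {set I} * {ffun I -> C}) :=
  [forall i in x.1, (i \in Big) && (b < mult i (x.2 i))] && dinjectiveb x.2 x.1.
have [[U f] /andP[/forall_inP /= Umult /dinjectiveP /= injU] maxU] :
    {x | valid x & forall y, valid y -> #|y.1| <= #|x.1|}.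
  have v0 : valid (set0, [ffun=> c0]).
    apply/andP; split; first by apply/forall_inP=> i; rewrite inE.
    by apply/dinjectiveP=> i j; rewrite inE.
  case: (arg_maxnP (fun x : {set I} * {ffun I -> C} => #|x.1|) v0) => x vx mx.
  by exists x => // y /mx.
pose D := f @: U.
have cardD : #|D| = #|U| by apply: card_in_imset.
have UBig : U \subset Big by apply/subsetP=> i /Umult/andP[].
have leUBig := subset_leq_card UBig.
have usedD i c : i \in Big -> i \notin U -> b < mult i c -> c \in D.
  move=> iB iU ic; apply: contraT => cD.
  have := maxU (i |: U, [ffun j => if j == i then c else f j]).
  rewrite /= cardsU1 iU ltnn; apply; apply/andP; split.
    apply/forall_inP=> j; rewrite /= !inE ffunE; case: eqVneq => [-> _|_ /= jU].
      by rewrite ic andbT; move: iB; rewrite inE.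
    by have := Umult j jU; rewrite inE.
  have fNc j : j \in U -> c <> f j by move=> jU cf; rewrite cf imset_f in cD.
  apply/dinjectiveP=> j l; rewrite /= !inE !ffunE.
  case: eqVneq => [->|ji] /=; case: eqVneq => [->|li] //= jU lU.
  - by move/(fNc _ lU).
  - by move/esym/(fNc _ jU).
  - exact: injU.
(* Each representative goes to all vertices of its part that accept it; [X'] is what remains, to be
   coloured without [D]. *)
pose L' v := L v :\: D.
pose X' := [set v in X | ~~ ((p v \in U) && (f (p v) \in L v))].
have X'X : X' \subset X by apply/subsetP=> v; rewrite inE => /andP[].
have fibX'U i : i \in U -> #|fiber p X' i| <= 1.
  move=> iU; have := Umult i iU; rewrite inE => /andP[/eqP iB].
  have := cardsID [set v | f i \in L v] (fiber p X i).
  rewrite iB /mult.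
  rewrite (_ : _ :&: _ = [set v in fiber p X i | f i \in L v]); last first.
    by apply/setP=> v; rewrite !inE.
  rewrite (_ : fiber p X i :\: _ = fiber p X' i); first by lia.
  apply/setP=> v; rewrite !inE.
  case: (eqVneq (p v) i) => [->|]; rewrite ?andbF //.
  by rewrite iU /= !andbT andbC.
have fibXJ i : {in fiber p X i, forall v, #|J| <= #|L v|}.
  by move=> v; rewrite inE => /andP[/JL].
(* By maximality a colour outside [D] lies in at most b lists of this part; a colour of [D] lies in
   at most b+1, since none is common to all b+2. *)
have unusedN i : i \in Big -> i \notin U ->
    #|J| * b.+2 <= b * #|colors_on L (fiber p X i)| + #|U|.
  move=> iB iU; have := iB; rewrite inE -cardD => /eqP Xi; rewrite -Xi.
  apply: card_lists_bound => // c; have := @usedD i c iB iU.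
  have := @lt_mult i c; rewrite Xi /mult; case: (c \in D) => /=; first lia.
  by move=> _ mD; rewrite addn0 leqNgt; apply/negP=> /mD.
have X'le : #|X'| + b.+1 * #|U| <= b.+1 * #|J| + #|Big|.
  apply: (@card_fibers_bound _ _ p).
  - by move=> v /(subsetP X'X)/pJ.
  - exact: subset_trans UBig BigJ.
  move=> i _; have [iU|iU] := boolP (i \in U).
    by rewrite (subsetP UBig) //=; have := fibX'U i iU; lia.
  have := card_fiberS p i X'X; have := le_fib i.
  by rewrite [in _ + (_ \in _)]inE; lia.
have Xle : #|X| <= b.+1 * #|J| + #|Big|.
  have := @card_fibers_bound _ _ p X J set0 Big b.+1 pJ (sub0set _).
  rewrite cards0 muln0 addn0; apply=> i _; have := le_fib i.
  rewrite !inE; lia.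
have hall' (Y : {set V}) : Y \subset X' -> #|Y| <= b * #|colors_on L' Y|.
  move=> YX'; have YX := subset_trans YX' X'X.
  have pJY := sub_in1 (subsetP YX) pJ.
  have cardN : #|colors_on L Y :&: D| + #|colors_on L' Y| = #|colors_on L Y|.
    by rewrite colors_onD cardsID.
  have leY := subset_leq_card YX'.
  have leN := leq_mul (leqnn b) (subset_leq_card (colors_onS L YX)).
  have [/existsP[i /andP[iY full]] | /existsPn noFull] :=
      boolP [exists i, (fiber p X i \subset Y) &&
                       ((#|fiber p X i| == b.+1) || (i \in Big :\: U))].
    have leNi := leq_mul (leqnn b) (subset_leq_card (colors_onS L iY)).
    have leND : #|colors_on L Y :&: D| <= #|U|.
      by rewrite -cardD subset_leq_card // subsetIr.
    (* Removing [D] costs at most b|U| in capacity, while [X'le] saves (b+1)|U| vertices; the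
       difference is |U|. *)
    suff : b.+1 * #|J| + #|Big| <= b * #|colors_on L Y| + #|U|.
      by have := leq_mul (leqnn b) leND; lia.
    have [iBU|iBU] := boolP (i \in Big :\: U).
      move: iBU; rewrite inE => /andP[iU iB]; have := unusedN i iB iU.
      by move: leBigJ leNi; clear; lia.
    move: full; rewrite (negPf iBU) orbF => /eqP Xi.
    have leJ : #|J| * b.+1 <= b * #|colors_on L (fiber p X i)|.
      rewrite -Xi -[leqRHS]addn0 -(cards0 C); apply: card_lists_bound => // c.
      by rewrite inE addn0; have := @lt_mult i c; rewrite Xi /mult; lia.
    have [BigU|/subsetPn[i' i'B i'U]] := boolP (Big \subset U).
      by have := subset_leq_card BigU; move: leJ leNi; clear; lia.
    have i'X : fiber p X i' \subset X.
      by apply/subsetP=> v; rewrite inE => /andP[].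
    have leNi' := subset_leq_card (colors_onS L i'X).
    have := unusedN i' i'B i'U.
    (* Criticality enters: b|L(X)| < |X| <= (b+1)|J| + |Big| <= b|L(Y)| + b. *)
    have : #|colors_on L X| <= #|colors_on L Y|.
      rewrite -ltnS -(ltn_pmul2l b_gt0) mulnS.
      by move: crit Xle leBig leJ leNi; clear; lia.
    move=> /(leq_trans leNi')/(leq_mul (leqnn b)).
    by move: leBigJ; clear; lia.
  have fibY i : i \notin U -> #|fiber p Y i| <= b + (i \in Big).
    move=> iU; have := noFull i; rewrite in_setD iU negb_and negb_or /=.
    have := le_fib i; rewrite [in _ + (_ \in _)]inE.
    case/boolP: (fiber p X i \subset Y) => [_|/subsetPn[v vi vY] + _].
      by have := card_fiberS p i YX; rewrite inE; lia.
    have : fiber p Y i \proper fiber p X i.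
      apply/properP; split; last by exists v; rewrite // inE (negPf vY).
      by apply/subsetP=> u; rewrite !inE => /andP[/(subsetP YX)-> ->].
    by move/proper_card; lia.
  have fibYU i : i \in U -> #|fiber p Y i| <= 1.
    by move=> iU; apply: leq_trans (fibX'U i iU); apply: card_fiberS.
  have Yle : #|Y| + b * #|U| <= b * #|J| + #|Big|.
    apply: (card_fibers_bound pJY); first exact: subset_trans UBig BigJ.
    move=> i _; have [iU|/fibY] := boolP (i \in U); last by lia.
    by rewrite (subsetP UBig) //=; have := fibYU i iU; lia.
  have leND : #|colors_on L Y :&: D| <= #|U|.
    by rewrite -cardD subset_leq_card // subsetIr.
  (* If |L(Y)| > |J|, the extra capacity b absorbs |Big| in [Yle]. Otherwise all lists on [Y]
     coincide with L(Y). *)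
  have [NJ|] := leqP #|colors_on L Y| #|J|; last first.
    by move/(leq_mul (leqnn b)); have := leq_mul (leqnn b) leND; lia.
  have eqL : {in Y, forall v, L v = colors_on L Y}.
    move=> v vY; apply/eqP; rewrite eqEcard sub_colors_on //.
    by apply: leq_trans NJ _; apply/JL/(subsetP YX).
  have [->|[v0 v0Y]] := set_0Vmem Y; first by rewrite cards0.
  have {}NJ : #|colors_on L Y| = #|J|.
    by apply/eqP; rewrite eqn_leq NJ -(eqL v0 v0Y); apply/JL/(subsetP YX).
  (* A vertex of [Y] in a part of [W] would accept its representative and so not be in [X']. Hence
     [Y] misses these parts, which pays for the colours of L(Y) lost to [D]. *)
  pose W := [set i in U | f i \in colors_on L Y].
  have leW : #|colors_on L Y :&: D| <= #|W|.
    apply: leq_trans (leq_imset_card f W); apply/subset_leq_card/subsetP=> c.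
    rewrite inE => /andP[cN /imsetP[i iU ci]]; apply/imsetP; exists i => //.
    by rewrite inE iU -ci.
  have : #|Y| + b * #|W| <= b * #|J| + #|set0 : {set I}|.
    apply: (card_fibers_bound pJY).
      apply: subset_trans (subset_trans UBig BigJ).
      by apply/subsetP=> i; rewrite inE => /andP[].
    move=> i _; rewrite in_set0 addn0; have [|iW] := boolP (i \in W).
      rewrite inE => /andP[iU fi].
      rewrite (_ : fiber p Y i = set0) ?cards0 ?muln1 //.
      apply/setP=> v; rewrite !inE; apply/negP=> /andP[vY /eqP vi].
      have := subsetP YX' v vY; rewrite inE vi iU => /andP[_ /negP[]].
      by rewrite eqL.
    rewrite muln0 addn0; have [iU|iU] := boolP (i \in U).
      exact: leq_trans (fibYU i iU) b_gt0.
    have [iB|iB] := boolP (i \in Big); last first.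
      by have := fibY i iU; rewrite (negPf iB) addn0.
    rewrite leqNgt; apply/negP=> ltY.
    have : #|colors_on L Y| <= #|D|.
      apply/subset_leq_card/subsetP=> c cN; apply: (usedD i) => //.
      apply: leq_trans ltY _; apply/subset_leq_card/subsetP=> v.
      rewrite !inE => /andP[vY ->]; rewrite (subsetP YX) // eqL //.
    have : U \proper Big by apply/properP; split=> //; exists i.
    by move/proper_card; lia.
  have := leq_mul (leqnn b) leW; rewrite cards0; lia.
have [g gL gb] := Hall_capacity c0 b_gt0 hall'.
exists (fun v => if (p v \in U) && (f (p v) \in L v) then f (p v) else g v).
split.
  move=> v vX; case: ifPn => [/andP[]//|vN].
  by have := gL v; rewrite !inE vX vN => /(_ isT)/andP[].
(* A colour of [D] stays in its own part, as [f] is injective on [U] and [g] avoids [D]; any other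
   colour is used only by [g]. *)
move=> c; have [/imsetP[i iU ->]|cD] := boolP (c \in D).
  right; exists i => v; rewrite inE => /andP[vX].
  case: ifPn => [/andP[vU _]|vN].
    by move/eqP/injU; apply.
  move/eqP=> gv; have := gL v; rewrite !inE vX vN gv => /(_ isT)/andP[].
  by rewrite imset_f.
left; apply: leq_trans (gb c); apply/subset_leq_card/subsetP=> v.
rewrite !inE; case: ifPn => [/andP[vU _] /andP[_ /eqP fc]|_ /andP[-> ->]] //.
by rewrite -fc imset_f in cD.
Qed.

(** * Induction on the number of vertices *)

Theorem good_coloring_exists (V I C : finType) (p : V -> I) (c0 : C) (b : nat)
    (L : V -> {set C}) (X : {set V}) (J : {set I}) : 0 < b ->
    {in X, forall v, p v \in J} ->
    {in X, forall v, #|J| <= #|L v|} ->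
    (forall i, #|fiber p X i| <= b.+2) ->
    #|[set i | #|fiber p X i| == b.+2]| <= b ->
  exists f, good_coloring p b L X f.
Proof.
move=> b_gt0; have [n] := ubnP #|X|; elim: n X J L => // n IHn X J L.
move=> /ltnSE-leXn pJ JL le_fib leBig.
have leBigS (Y : {set V}) : Y \subset X ->
    #|[set i | #|fiber p Y i| == b.+2]| <= b.
  move=> YX; apply: leq_trans leBig; apply/subset_leq_card/subsetP=> i.
  rewrite !inE eqn_leq => /andP[_ iY].
  by rewrite eqn_leq le_fib (leq_trans iY) ?card_fiberS.
(* A colour common to a part: dropping both the part and the colour lowers |J| by one and each list
   by at most one. *)
have [/existsP[i /existsP[c /andP[/set0Pn[v0 v0i] /forall_inP ci]]]|nocommon] :=
    boolP [exists i, exists c,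
             (fiber p X i != set0) && [forall v in fiber p X i, c \in L v]].
  pose Y := [set v in X | p v != i].
  have YX : Y \subset X by apply/subsetP=> v; rewrite inE => /andP[].
  have [v0X v0p] : v0 \in X /\ p v0 = i.
    by move: v0i; rewrite inE => /andP[-> /eqP].
  have [|||j||f [fL fgood]] := IHn Y (J :\ i) (fun v => L v :\ c).
  - apply: leq_trans leXn; apply/proper_card/properP; split=> //.
    by exists v0; rewrite // inE v0p eqxx andbF.
  - by move=> v; rewrite !inE => /andP[/pJ-> ->].
  - move=> v; rewrite inE => /andP[vX vi].
    have := JL v vX; rewrite (cardsD1 i) -{1}v0p pJ // (cardsD1 c (L v)).
    by case: (_ \in _) => /=; lia.
  - exact: leq_trans (card_fiberS _ _ YX) (le_fib j).
  - exact: leBigS.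
  exists (fun v => if p v == i then c else f v); split.
    move=> v vX; case: ifPn => [vi|vi]; first by apply: ci; rewrite inE vX.
    by have := fL v; rewrite !inE vX vi => /(_ isT)/andP[].
  move=> d; have [->|dc] := eqVneq d c.
    right; exists i => v; rewrite inE => /andP[vX].
    case: (eqVneq (p v) i) => // vi /eqP fv.
    by have := fL v; rewrite !inE vX vi fv eqxx => /(_ isT).
  rewrite (_ : fiber _ X d = fiber f Y d) //; apply/setP=> v; rewrite !inE.
  by case: (eqVneq (p v) i); rewrite ?andbF ?andbT // eq_sym (negPf dc) andbF.
have [crit|hallX] := ltnP (b * #|colors_on L X|) #|X|.
  apply: (good_coloring_critical c0 b_gt0 pJ JL) => // i c Xi.
  apply/exists_inP; apply: contraNT nocommon => iN.
  apply/existsP; exists i; apply/existsP; exists c; rewrite Xi.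
  apply/forall_inP => v vi; apply: contraNT iN => cv.
  by apply/exists_inP; exists v.
pose viol (Y : {set V}) := (Y \subset X) && (b * #|colors_on L Y| < #|Y|).
have [/existsP[Y0 violY0]|/existsPn noviol] := boolP [exists Y, viol Y];
  last first.
  have [Y YX|f fL fb] := @Hall_capacity _ _ c0 b L X b_gt0.
    by have := noviol Y; rewrite /viol YX -leqNgt.
  by exists f; split=> // c; left.
(* For a largest violating [Y], a set Z outside [Y] violating the condition for lists without L(Y)
   would make [Y :|: Z] a larger violating set. *)
case: (arg_maxnP (fun Y : {set V} => #|Y|) violY0) => Y /andP[YX violY] maxY.
have YpX : Y \proper X.
  rewrite properE YX; apply: contraL violY => XY; rewrite -leqNgt.
  by rewrite (_ : Y = X) //; apply/eqP; rewrite eqEsubset YX.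
have [|||i||f [fL fgood]] := IHn Y J L.
- exact: leq_trans (proper_card YpX) leXn.
- by move=> v /(subsetP YX)/pJ.
- by move=> v /(subsetP YX)/JL.
- exact: leq_trans (card_fiberS _ _ YX) (le_fib i).
- exact: leBigS.
have [Z|g gL gb] := @Hall_capacity _ _ c0 b (fun v => L v :\: colors_on L Y)
                      (X :\: Y) b_gt0.
  rewrite subsetD => /andP[ZX dZY]; rewrite colors_onD.
  rewrite leqNgt; apply/negP => ltZ.
  have ZY0 : Y :&: Z = set0 by apply/eqP; rewrite setIC setI_eq0.
  have [Z0|] := eqVneq Z set0; first by move: ltZ; rewrite Z0 cards0.
  rewrite -card_gt0 => Zgt0; have := maxY (Y :|: Z).
  have cardU : #|colors_on L Y :|: colors_on L Z| =
      #|colors_on L Y| + #|colors_on L Z :\: colors_on L Y|.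
    by rewrite -(cardsID (colors_on L Y)) setUK setDUl setDv set0U.
  rewrite /viol subUset YX ZX colors_onU cardU /= mulnDr.
  by rewrite [#|Y :|: Z|]cardsU ZY0 cards0; lia.
exists (fun v => if v \in Y then f v else g v); split.
  move=> v vX; case: ifPn => [/fL//|vY].
  by have := gL v; rewrite !inE vX vY => /(_ isT)/andP[].
move=> c; have [cY|cY] := boolP (c \in colors_on L Y).
  rewrite (_ : fiber _ X c = fiber f Y c) //; apply/setP=> v; rewrite !inE.
  case: ifPn => [/(subsetP YX)->//|vY]; apply/negbTE/negP=> /andP[vX /eqP gv].
  by have := gL v; rewrite !inE vX vY gv cY => /(_ isT).
left; apply: leq_trans (gb c); apply/subset_leq_card/subsetP=> v.
rewrite !inE; case: ifPn => [vY /andP[_ /eqP fv]|_ /andP[-> ->]//].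
by case/negP: cY; rewrite -fv (subsetP (sub_colors_on L vY)) // fL.
Qed.

(** * Complete multipartite hypergraphs: translation and both bounds *)

Lemma subset_of_card (T : finType) (A B : {set T}) (m : nat) :
    B \subset A -> #|B| <= m <= #|A| ->
  exists S : {set T}, [/\ B \subset S, S \subset A & #|S| = m].
Proof.
move=> BA /andP[]; elim: m => [|m IHm]; first by exists B; split=> //; lia.
rewrite leq_eqVlt => /predU1P[<- _|Bm mA]; first by exists B.
have [S [BS SA cardS]] := IHm Bm (ltnW mA).
have /subsetPn[x xA xS] : ~~ (A \subset S).
  by apply: contraL mA => /subset_leq_card; rewrite cardS -leqNgt.
exists (x |: S); split; first exact: subset_trans BS (subsetUr _ _).
  by rewrite subUset sub1set xA.
by rewrite cardsU1 xS cardS.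
Qed.

Lemma card_part (p : seq nat) (i : 'I_(size p)) : #|part i| = nth 0 p i.
Proof.
pose tagi := @Tagged _ i (fun i : 'I_(size p) => 'I_(nth 0 p i)).
have tagi_inj : injective tagi.
  by move=> x y /eqP; rewrite -tag_eqE /tag_eq eqxx tagged_asE => /eqP.
rewrite -[RHS]card_ord -(card_imset predT tagi_inj).
apply: eq_card => -[j x]; rewrite inE; apply/eqP/imsetP => /= [ji|[y _ e]].
  by move: x; rewrite ji => x; exists x.
exact: (congr1 tag e).
Qed.

(** A monochromatic set of at least r vertices that meets two parts contains an r-subset through a
    vertex of each, that is, a monochromatic edge; r > 1 leaves room for both vertices. *)
Lemma proper_complete_multipartite (r : nat) (p : seq nat) (C : Type)
    (c : vertex p -> C) : 1 < r ->
  Defs.proper (complete_multipartite r p) c <->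
  (forall A, monochromatic c A -> #|A| < r \/ exists i, A \subset part i).
Proof.
move=> r_gt1; split=> [propc A monoA|classes e].
  have [|rA] := ltnP #|A| r; [by left | right].
  have /card_gt0P[x xA] : 0 < #|A| by lia.
  exists (tag x); apply: contraT => /subsetPn[y yA]; rewrite inE => yx.
  have [||S [xyS SA cardS]] := @subset_of_card _ A [set x; y] r.
  - by apply/subsetP=> z; rewrite !inE => /orP[]/eqP->.
  - by rewrite rA cards2; case: (_ == _); lia.
  case: (propc S).
    rewrite inE cardS eqxx; apply/forallP=> i; apply: contra yx => /subsetP Si.
    have := Si x; have := Si y; rewrite !inE !(subsetP xyS) ?inE ?eqxx ?orbT //.
    by move=> /(_ isT)/eqP-> /(_ isT)/eqP->.
  by move=> u v /(subsetP SA) + /(subsetP SA); apply: monoA.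
rewrite inE => /andP[/eqP cardE /forallP eN] /classes[|[i ei]].
  by rewrite cardE ltnn.
by have := eN i; rewrite ei.
Qed.

Theorem complete_multipartite_choosable (r : nat) (p : seq nat) : 1 < r ->
    (forall i : 'I_(size p), nth 0 p i <= r.+1) ->
    #|[set i : 'I_(size p) | nth 0 p i == r.+1]| <= r.-1 ->
  choosable (complete_multipartite r p) (size p).
Proof.
move=> r_gt1 le_p leBig C L cardL.
(* Without vertices there may be no colour at all to serve as a default, so this case is
   separate. *)
have [v0 _|noV] := pickP (@predT (vertex p)); last first.
  have {}noV (v : vertex p) : False by have := noV v.
  exists (fun v => match noV v with end); split=> [e|v]; last by case: (noV v).
  rewrite inE => /andP[/eqP cardE _].
  have /card_gt0P[v _] : 0 < #|e| by rewrite cardE; lia.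
  by case: (noV v).
(* The union of all lists is a finite palette, which gives the [finType] of colours. *)
pose F := (\bigcup_(v <- enum (vertex p)) L v)%fset.
pose L' v := [set c : F | val c \in L v].
have LF v c : c \in L v -> c \in F.
  by move=> cv; apply/bigfcupP; exists v; rewrite ?mem_enum.
have cardL' v : size p <= #|L' v|.
  rewrite -(cardL v) cardE -(size_map val); apply: uniq_leq_size => // c cv.
  by apply/mapP; exists [` LF v c cv]%fset; rewrite // mem_enum inE.
have /card_gt0P[c0 _] : 0 < #|L' v0|.
  exact: leq_ltn_trans (leq0n _) (leq_trans (ltn_ord (tag v0)) (cardL' v0)).
have fiberE i : #|fiber (fun v : vertex p => tag v) setT i| = nth 0 p i.
  by rewrite -card_part; apply: eq_card => v; rewrite !inE.
have [|||i||f [fL fgood]] :=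
  @good_coloring_exists _ _ _ (fun v : vertex p => tag v) c0 r.-1 L' setT setT.
- lia.
- by move=> v; rewrite inE.
- by move=> v _; rewrite cardsT card_ord.
- by rewrite fiberE; have := le_p i; lia.
- apply: leq_trans leBig; apply/subset_leq_card/subsetP=> i.
  by rewrite !inE fiberE; lia.
exists (fun v => val (f v)); split; last first.
  by move=> v; have := fL v; rewrite !inE => /(_ isT).
apply/proper_complete_multipartite => // A monoA.
have [->|[x xA]] := set_0Vmem A; first by left; rewrite cards0; lia.
have Af : A \subset fiber f setT (f x).
  by apply/subsetP=> y yA; rewrite !inE; apply/eqP/val_inj/monoA.
case: (fgood (f x)) => [le_r|[i fi]].
  by left; have := subset_leq_card Af; lia.
by right; exists i; apply/subsetP=> y /(subsetP Af)/fi; rewrite inE => ->.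
Qed.

(* Restricting every part to r vertices makes each colour class have at most r
   vertices, whether it lies inside a part or not. *)
Theorem choosable_complete_multipartite_ge (r : nat) (p : seq nat) (j : nat) :
    1 < r -> (forall i : 'I_(size p), r <= nth 0 p i) ->
  choosable (complete_multipartite r p) j -> size p <= j.
Proof.
move=> r_gt1 le_p choos.
(* With every list equal to {0, ..., j-1}, [c] is an ordinary colouring with j colours. *)
have [|c [propc cj]] := choos nat (fun=> [fset m in iota 0 j]%fset).
  by move=> v; rewrite card_fseq undup_id ?iota_uniq ?size_iota.
have {}cj v : c v < j by have := cj v; rewrite in_fset /= mem_iota.
pose emb (x : 'I_(size p) * 'I_r) : vertex p :=
  Tagged (fun i : 'I_(size p) => 'I_(nth 0 p i)) (widen_ord (le_p x.1) x.2).
have emb_inj : injective emb.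
  move=> [i x] [i' x'] /eqP; rewrite -tag_eqE /tag_eq /= => /andP[/eqP ii'].
  case: _ / ii' in x' *; rewrite tagged_asE => /eqP/(congr1 val) /= xx'.
  by congr (_, _); apply: val_inj.
pose d x : 'I_j := Ordinal (cj (emb x)).
have le_class i : #|fiber d setT i| <= r.
  rewrite -(card_imset _ emb_inj).
  have [|/ltnW //|[l /subsetP sub_l]] :=
      (proper_complete_multipartite c r_gt1).1 propc (emb @: fiber d setT i).
    move=> _ _ /imsetP[x + ->] /imsetP[y + ->].
    by rewrite !inE => /eqP/(congr1 val) /= -> /eqP/(congr1 val) /= ->.
  rewrite card_imset // -[leqRHS]card_ord.
  rewrite -(card_in_imset (f := snd) (D := fiber d setT i)).
    exact: max_card.
  move=> [a x] [a' x'] xd x'd /= xx'; congr (_, _) => //.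
  have := sub_l _ (imset_f emb xd); have := sub_l _ (imset_f emb x'd).
  by rewrite !inE /= => /eqP-> /eqP->.
have := @card_fibers _ _ d setT setT (in1W (fun=> in_setT _)).
rewrite cardsT card_prod !card_ord => cardE.
have : size p * r <= j * r.
  by rewrite cardE -[in leqRHS](card_ord j) -cardsT -sum_nat_const leq_sum.
by rewrite leq_pmul2r //; lia.
Qed.

Theorem theorem4p7 (r k : nat) (hr : 2 <= r) (hk : r - 1 <= k) :
  is_list_chromatic_number
    (complete_multipartite r (nseq (r - 1) (r + 1) ++ nseq (k - (r - 1)) r)) k.
Proof.
set p := _ ++ _.
have size_p : size p = k by rewrite size_cat !size_nseq subnKC.
have nth_p (i : 'I_(size p)) : nth 0 p i = r + (i < r - 1).
  have ik : i < k by rewrite -[ltnRHS]size_p.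
  rewrite nth_cat !nth_nseq size_nseq; case: ltnP => //= rk.
  by rewrite ifT ?addn0 //; lia.
split=> [|j]; rewrite -{1}size_p.
  apply: complete_multipartite_choosable => // [i|].
    by rewrite nth_p; lia.
  (* The parts of size r+1 are those with index below r-1. *)
  rewrite cardE -(size_map val) -subn1 -[leqRHS](size_iota 0).
  apply: uniq_leq_size.
    by rewrite (map_inj_uniq val_inj) enum_uniq.
  move=> _ /mapP[i + ->]; rewrite mem_enum inE nth_p mem_iota /=.
  by case: ltnP => //; lia.
by apply: choosable_complete_multipartite_ge => // i; rewrite nth_p leq_addr.
Qed.
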